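(* Let $F\in\mathcal F$ and let $\Gamma=\sum_{i=1}^r v_iv_i^T\succ 0$ with $v_1,\dots,v_r\in\mathbb R^{n+m}$ fixed. The gradient at $F$ of the map $F\mapsto J_\alpha(F,\Gamma)$ is $$\nabla_F J_\alpha(F,\Gamma)=2P_{12}^T(S_{11}-\Gamma_{11})+2P_{22}F(S_{11}-\Gamma_{11}),$$ where $S$ and $P$ are the solutions in $\mathbb S^{n+m}$ of $$S=\alpha A_F S A_F^T+\Gamma\qquad\text{and}\qquad \alpha A_F^TPA_F-P+\Lambda=0,$$ respectively.
   Context: $\mathbb S^{p}$ is the set of symmetric real $p\times p$ matrices. The linear system is $x(k+1)=Ax(k)+Bu(k)$ with $A\in\mathbb R^{n\times n}$, $B\in\mathbb R^{n\times m}$. The weights $Q\in\mathbb S^n$, $Q\succeq 0$, and $R\in\mathbb S^m$, $R\succ 0$, are fixed, and $\Lambda:=\begin{bmatrix} Q&0\\ 0&R\end{bmatrix}$. The discount factor is $\alpha\in(0,1]$. $\rho(\cdot)$ denotes the spectral radius and $\mathcal F:=\{F\in\mathbb R^{m\times n}:\rho(A+BF)<1\}$ is the set of stabilizing gains. For $F\in\mathbb R^{m\times n}$, $$A_F:=\begin{bmatrix} A&B\\ FA&FB\end{bmatrix}\in\mathbb R^{(n+m)\times(n+m)}.$$ For $v_0\in\mathbb R^{n+m}$, $v(k;F,v_0)$ denotes the solution at time $k$ of the augmented system $v(k+1)=A_Fv(k)$, $v(0)=v_0$ (here $v(k)=\begin{bmatrix} x(k)\\ u(k)\end{bmatrix}$,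 where $u(0)$ is free and $u(k)=Fx(k)$ for $k\ge 1$). The cost is $$J_\alpha(F,\Gamma):=\sum_{i=1}^r\sum_{k=0}^\infty \alpha^k v(k;F,v_i)^T\Lambda v(k;F,v_i).$$ A matrix $M\in\mathbb S^{n+m}$ is partitioned as $M=\begin{bmatrix} M_{11}&M_{12}\\ M_{12}^T&M_{22}\end{bmatrix}$ with $M_{11}\in\mathbb S^n$, $M_{12}\in\mathbb R^{n\times m}$, $M_{22}\in\mathbb S^m$. The gradient $\nabla_F f(F)\in\mathbb R^{m\times n}$ of a scalar function $f$ is the matrix $X$ such that the differential is $df=\mathrm{Tr}(dF^T X)$. *)

(* Defs.v *)
From HB Require Import structures.
From mathcomp Require Import all_boot all_order all_algebra.
From mathcomp Require Import complex.
From mathcomp Require Import all_classical all_reals all_analysis.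

Set Implicit Arguments.
Unset Strict Implicit.
Unset Printing Implicit Defensive.

Import Order.TTheory GRing.Theory Num.Theory.
Import numFieldNormedType.Exports.

Local Open Scope ring_scope.
Local Open Scope classical_set_scope.

Section LinearAlgebra.
Context {K : realType}.

Definition qform p (M : 'M[K]_p) (x : 'cV[K]_p) : K := (x^T *m M *m x) 0 0.

Definition psdmx p (M : 'M[K]_p) : Prop :=
  M \is symmetricmx /\ forall x, 0 <= qform M x.

Definition pdmx p (M : 'M[K]_p) : Prop :=
  M \is symmetricmx /\ forall x, x != 0 -> 0 < qform M x.

(* The supremum is over the complex eigenvalues of the real matrix M; it is 0
   when p = 0, by the convention sup set0 = 0. *)
Definition spectral_radius p (M : 'M[K]_p) : K :=
  sup [set Normc.normc z | z in [set z : K[i] |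
    eigenvalue (map_mx (real_complex K) M) z]].

Definition gram p r (v : 'I_r -> 'cV[K]_p) : 'M[K]_p :=
  \sum_(i < r) v i *m (v i)^T.

(* is_diff packs Frechet differentiability with the value of the differential. *)
Definition is_gradient m n (f : 'M[K]_(m, n) -> K) (F X : 'M[K]_(m, n)) : Prop :=
  is_diff F f (fun H : 'M[K]_(m, n) => \tr (H^T *m X) : K).

End LinearAlgebra.

Section LQR.
Context {K : realType} {n m : nat}.
Context (A : 'M[K]_n) (B : 'M[K]_(n, m)).

Definition stabilizing : set 'M[K]_(m, n) :=
  [set F | spectral_radius (A + B *m F) < 1].

Definition augmented (F : 'M[K]_(m, n)) : 'M[K]_(n + m) :=
  block_mx A B (F *m A) (F *m B).

Definition weight (Q : 'M[K]_n) (R : 'M[K]_m) : 'M[K]_(n + m) :=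
  block_mx Q 0 0 R.

(* The input block of v0 is free; feedback F acts from time 1 on. *)
Definition trajectory (F : 'M[K]_(m, n)) (v0 : 'cV[K]_(n + m)) (k : nat) :
    'cV[K]_(n + m) :=
  iter k (mulmx (augmented F)) v0.

(* The infinite sums are limits in K, hence meaningful only at gains F for
   which the series converge; for 0 < alpha <= 1 this holds in a neighbourhood
   of every stabilizing gain. *)
Definition cost (Q : 'M[K]_n) (R : 'M[K]_m) (alpha : K) r
    (v : 'I_r -> 'cV[K]_(n + m)) (F : 'M[K]_(m, n)) : K :=
  \sum_(i < r) limn (series (fun k : nat =>
    alpha ^+ k * qform (weight Q R) (trajectory F (v i) k))).

Definition is_lyapunov_S (alpha : K) (F : 'M[K]_(m, n))
    (Gam S : 'M[K]_(n + m)) : Prop :=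
  S \is symmetricmx /\
  S = alpha *: (augmented F *m S *m (augmented F)^T) + Gam.

Definition is_lyapunov_P (Q : 'M[K]_n) (R : 'M[K]_m) (alpha : K)
    (F : 'M[K]_(m, n)) (P : 'M[K]_(n + m)) : Prop :=
  P \is symmetricmx /\
  alpha *: ((augmented F)^T *m P *m augmented F) - P + weight Q R = 0.

End LQR.

(* Main.v *)
From HB Require Import structures.
Require Import Defs.
From mathcomp Require Import all_boot all_order all_algebra.
From mathcomp Require Import complex.
From mathcomp Require Import all_classical all_reals all_analysis.
From mathcomp Require Import ring lra.

Set Implicit Arguments.
Unset Strict Implicit.
Unset Printing Implicit Defensive.

Import Order.TTheory GRing.Theory Num.Theory.
Import numFieldNormedType.Exports.

Local Open Scope ring_scope.
Local Open Scope classical_set_scope.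

(** Every trajectory of the augmented system is [v k = M ^+ k v 0] with
    [M = augmented F], so wherever the powers of [M] decay the cost telescopes
    to [\tr (P Gam)], where [P] solves the discrete Lyapunov (Stein) equation
    [P = alpha M^T P M + W] with [W = weight Q R] ([cost_stein]). The theorem is
    the derivative of this trace in the direction of a perturbation [E] of [M].

    Let [P'] solve the equation for [M + E]. Since [Gam = S - alpha M S M^T],
    moving the Stein operator from one factor of the trace to the other gives
    the exact identity ([stein_trace_sub])
      [\tr (P' Gam) - \tr (P Gam)
         = alpha \tr (((M + E)^T P' (M + E) - M^T P' M) S)].
    Replacing [P'] by [P] and dropping the term quadratic in [E] leaves
    [alpha \tr ((E^T P M + M^T P E) S)], which for [E = (0; H) (A B)] is the
    pairing of [H] with the announced gradient ([feedback_differential]): the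
    blocks of [P] come from [(0; 1)^T P (1; F)], and
    [alpha (A B) S (A B)^T = S11 - Gam11] is the upper left block of the
    equation for [S].

    What remains is to bound the error by a multiple of the square of [E], which
    needs estimates that are uniform in a neighbourhood of [F]. All of them
    follow from a bound [c q ^ k] with [q < 1] on the powers of [M]:
    - it survives small perturbations of [M], with the same [c] and with [q]
      increased in proportion to the perturbation ([pow_bound_perturbed]);
    - it bounds the solution of a Stein equation by its right-hand side, with a
      constant that depends on [c] and [q] only ([stein_bound]). Uniqueness
      follows; existence follows from uniqueness, the Stein operator being an
      endomorphism of a finite-dimensional space.
    Hence [P'] is bounded and [P' - P] is of the order of [E].

    The decay itself comes from the spectral radius of [A + B F]. Over the
    complex numbers the characteristic polynomial splits, and by Cayley-Hamilton
    the product of the factors [M - z] vanishes; removing the factors one at a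
    time, each removal solves a first-order recurrence with ratio [z]
    ([pow_bound_eigenvalue]). The augmented matrix factors as [(1; F) (A B)],
    and [(A B) (1; F) = A + B F], so that its powers decay as well
    ([augmented_power_stable]). *)

(** * The entrywise l1 norm of matrices *)

Section L1.
Context {K : numDomainType}.

(** Unlike the maximum norm, this norm is submultiplicative for matrices of all
    sizes, so that no dimension enters the estimates; and it makes sense for
    real and for complex entries alike. *)
Definition l1norm m n (X : 'M[K]_(m, n)) : K := \sum_i \sum_j `|X i j|.

Lemma l1norm_ge0 m n (X : 'M[K]_(m, n)) : 0 <= l1norm X.
Proof. by apply: sumr_ge0 => i _; apply: sumr_ge0. Qed.

Lemma l1norm0 m n : l1norm (0 : 'M[K]_(m, n)) = 0.
Proof. by apply: big1 => i _; apply: big1 => j _; rewrite mxE normr0. Qed.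

Lemma l1normD m n (X Y : 'M[K]_(m, n)) : l1norm (X + Y) <= l1norm X + l1norm Y.
Proof.
rewrite -big_split; apply: ler_sum => i _; rewrite -big_split.
by apply: ler_sum => j _; rewrite mxE ler_normD.
Qed.

Lemma l1normZ m n a (X : 'M[K]_(m, n)) : l1norm (a *: X) = `|a| * l1norm X.
Proof.
rewrite mulr_sumr; apply: eq_bigr => i _; rewrite mulr_sumr.
by apply: eq_bigr => j _; rewrite mxE normrM.
Qed.

Lemma l1norm_tr m n (X : 'M[K]_(m, n)) : l1norm X^T = l1norm X.
Proof.
rewrite /l1norm exchange_big; apply: eq_bigr => i _; apply: eq_bigr => j _.
by rewrite mxE.
Qed.

Lemma l1norm_eq0 m n (X : 'M[K]_(m, n)) : l1norm X = 0 -> X = 0.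
Proof.
move/eqP; rewrite psumr_eq0; last by move=> i _; exact: sumr_ge0.
move/allP => X0; apply/matrixP => i j; rewrite mxE.
move: (X0 i); rewrite mem_index_enum => /(_ isT).
rewrite psumr_eq0 // => /allP /(_ j); rewrite mem_index_enum => /(_ isT).
by rewrite normr_eq0 => /eqP.
Qed.

Lemma entry_le_l1norm m n (X : 'M[K]_(m, n)) i j : `|X i j| <= l1norm X.
Proof.
rewrite /l1norm (bigD1 i) //= (bigD1 j) //= -addrA lerDl.
by apply: addr_ge0; apply: sumr_ge0 => // k _; exact: sumr_ge0.
Qed.

Lemma l1normM m n p (X : 'M[K]_(m, n)) (Y : 'M[K]_(n, p)) :
  l1norm (X *m Y) <= l1norm X * l1norm Y.
Proof.
rewrite /l1norm mulr_suml; apply: ler_sum => i _; rewrite mulr_suml.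
apply: (@le_trans _ _ (\sum_k \sum_j `|X i j| * `|Y j k|)).
  apply: ler_sum => k _; rewrite mxE; apply: le_trans (ler_norm_sum _ _ _) _.
  by apply: ler_sum => j _; rewrite normrM.
rewrite exchange_big; apply: ler_sum => j _; rewrite -mulr_sumr.
apply: ler_wpM2l => //; rewrite (bigD1 j) //= lerDl.
by apply: sumr_ge0 => l _; exact: sumr_ge0.
Qed.

Lemma l1normMM m n p q
    (X : 'M[K]_(m, n)) (Y : 'M[K]_(n, p)) (Z : 'M[K]_(p, q)) :
  l1norm (X *m Y *m Z) <= l1norm X * l1norm Y * l1norm Z.
Proof.
apply: le_trans (l1normM _ _) _; apply: ler_wpM2r (l1normM _ _).
exact: l1norm_ge0.
Qed.

Lemma l1norm_trace n (X : 'M[K]_n) : `|\tr X| <= l1norm X.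
Proof.
apply: le_trans (ler_norm_sum _ _ _) _; apply: ler_sum => i _.
by rewrite (bigD1 i) //= lerDl sumr_ge0.
Qed.

End L1.

(** * Geometric decay of matrix powers from eigenvalue bounds *)
Section Pow.
Context {K : numClosedFieldType}.

(** The matrices [y k = M ^+ k N] satisfy [y (k + 1) = z y k + w k] with [w]
    bounded by [c q ^ k]; as [|z| < q], the bound passes to [y], the constant
    being chosen so that the induction step closes. *)
Lemma pow_recurrence_bound p (M N : 'M[K]_p) (z q c : K) : `|z| < q -> 0 <= c ->
  (forall k, l1norm (M ^+ k *m (M *m N - z *: N)) <= c * q ^+ k) ->
  forall k, l1norm (M ^+ k *m N) <= (l1norm N + c / (q - `|z|)) * q ^+ k.
Proof.
move=> zq c0 H.
have q0 : 0 < q by apply: le_lt_trans zq.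
have d0 : 0 < q - `|z| by rewrite subr_gt0.
elim=> [|k IH].
  by rewrite expr0 mul1mx mulr1 lerDl divr_ge0 // ltW.
set D := l1norm N + _ in IH *.
have cD : c <= D * (q - `|z|).
  by rewrite /D mulrDl divfK ?gt_eqF // lerDr mulr_ge0 ?l1norm_ge0 // ltW.
have -> : M ^+ k.+1 *m N = z *: (M ^+ k *m N) + M ^+ k *m (M *m N - z *: N).
  by rewrite mulmxBr -scalemxAr addrC subrK exprSr -mulmxA.
apply: le_trans (l1normD _ _) _; rewrite l1normZ.
apply: (@le_trans _ _ (`|z| * (D * q ^+ k) + c * q ^+ k)).
  by rewrite lerD ?ler_wpM2l.
rewrite mulrA -mulrDl exprS mulrA ler_wpM2r ?exprn_ge0 ?(ltW q0) //.
apply: le_trans (lerD (lexx _) cD) _.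
by rewrite mulrBr [D * `|z|]mulrC addrC subrK.
Qed.

(** Induction on the roots: [(M - z) N] is annihilated by the remaining factors,
    hence decays, and [N] decays by the recurrence with ratio [z]. The auxiliary
    [N] is what makes this induction possible. *)
Lemma pow_bound_annihilated p (M N : 'M[K]_p.+1) (q : K) (s : seq K) : 0 < q ->
  (forall z, z \in s -> `|z| < q) ->
  horner_mx M (\prod_(z <- s) ('X - z%:P)) *m N = 0 ->
  exists2 c, 0 <= c & forall k, l1norm (M ^+ k *m N) <= c * q ^+ k.
Proof.
move=> q0; elim: s N => [|z s IH] N zs.
  rewrite big_nil rmorph1 mul1mx => ->; exists 0 => // k.
  by rewrite mulmx0 l1norm0 mul0r.
rewrite big_cons mulrC rmorphM -mulmxA rmorphB /= horner_mx_X horner_mx_C.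
rewrite mulmxBl mul_scalar_mx => /IH [|c c0 H].
  by move=> w ws; apply: zs; rewrite inE ws orbT.
have zq : `|z| < q by apply: zs; rewrite mem_head.
exists (l1norm N + c / (q - `|z|)); last exact: pow_recurrence_bound.
by rewrite addr_ge0 ?l1norm_ge0 // divr_ge0 // subr_ge0 ltW.
Qed.

Lemma pow_bound_eigenvalue p (M : 'M[K]_p) (q : K) : 0 < q ->
  (forall z, eigenvalue M z -> `|z| < q) ->
  exists2 c, 0 <= c & forall k, l1norm (M ^+ k) <= c * q ^+ k.
Proof.
case: p M => [|p] M q0 Mq.
  by exists 0 => // k; rewrite /l1norm big_ord0 mul0r.
have [s Ms] := closed_field_poly_normal (char_poly M).
rewrite (monicP (char_poly_monic M)) scale1r in Ms.
have [||c c0 H] := @pow_bound_annihilated p M 1%:M q s q0.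
- by move=> z zs; apply: Mq; rewrite eigenvalue_root_char Ms root_prod_XsubC.
- by rewrite -Ms Cayley_Hamilton mul0mx.
by exists c => // k; have := H k; rewrite mulmx1.
Qed.
End Pow.

Section Spectral.
Context {K : realType}.

Lemma l1norm_complex m n (X : 'M[K]_(m, n)) :
  l1norm (map_mx (real_complex K) X) = real_complex K (l1norm X).
Proof.
rewrite /l1norm rmorph_sum; apply: eq_bigr => i _; rewrite rmorph_sum.
apply: eq_bigr => j _; rewrite mxE normc_def /=.
by rewrite expr0n addr0 sqrtr_sqr.
Qed.

(** A supremum is an upper bound only of a set that is bounded: here the
    eigenvalues are among the finitely many roots of the characteristic
    polynomial, and the sum of their moduli bounds each one of them. *)
Lemma normc_eigenvalue_le p (M : 'M[K]_p) (z : K[i]) :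
  eigenvalue (map_mx (real_complex K) M) z ->
  Normc.normc z <= spectral_radius M.
Proof.
move=> Mz; apply: sup_upper_bound; last by exists z.
set M' := map_mx _ _ in Mz *; split; first by exists (Normc.normc z), z.
have [s Ms] := closed_field_poly_normal (char_poly M').
exists (\sum_(w <- s) Normc.normc w) => _ [w Mw <-].
have ws : w \in s.
  move: Mw; rewrite /= eigenvalue_root_char Ms.
  by rewrite (monicP (char_poly_monic _)) scale1r root_prod_XsubC.
rewrite (big_rem w) //= lerDl; apply: sumr_ge0 => u _.
by case: u => a b; rewrite /Normc.normc sqrtr_ge0.
Qed.

Lemma spectral_pow_bound p (M : 'M[K]_p) : spectral_radius M < 1 ->
  exists c q, [/\ 0 <= c, 0 < q, q < 1 &
    forall k, l1norm (M ^+ k) <= c * q ^+ k].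
Proof.
(* Halfway to 1, so as to be positive and to exceed every eigenvalue strictly. *)
move=> rho1; set q : K := (Num.max (spectral_radius M) 0 + 1) / 2.
have mx1 : Num.max (spectral_radius M) 0 < 1 by rewrite gt_max rho1 ltr01.
have mx0 : 0 <= Num.max (spectral_radius M) 0 by rewrite le_max lexx orbT.
have rm : spectral_radius M <= Num.max (spectral_radius M) 0.
  by rewrite le_max lexx.
have [|z Mz|c c0 H] :=
  @pow_bound_eigenvalue _ _ (map_mx (real_complex K) M) q%:C%C.
- by rewrite ltcR /q; lra.
- have -> : `|z| = (Normc.normc z)%:C%C by rewrite normc_def; case: (z).
  by rewrite ltcR /q; have := normc_eigenvalue_le Mz; lra.
exists (complex.Re c), q; split; rewrite /q; try lra.
  by move: c0; rewrite lecE => /andP[_].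
move=> k; move: (H k); rewrite -rmorphXn /= l1norm_complex.
by rewrite -rmorphXn lecE => /andP[_]; case: (c) => a b /=; rewrite mulr0 subr0.
Qed.
End Spectral.

(** * Stein equations with a power-stable matrix *)

Section Stein.
Context {K : realType}.

(** The estimate is proved for [M ^+ j N ^+ k] at all [j] simultaneously, by
    induction on [k]: writing [N = M + (N - M)], the first summand is absorbed
    in the power of [M] and gains a factor [q], the second costs a factor
    [c * l1norm (N - M)]. *)
Lemma pow_bound_perturbed p (M N : 'M[K]_p) (c q : K) : 0 <= c -> 0 <= q ->
  (forall k, l1norm (M ^+ k) <= c * q ^+ k) ->
  forall k, l1norm (N ^+ k) <= c * (q + c * l1norm (N - M)) ^+ k.
Proof.
move=> c0 q0 H; set s := q + _.
have s0 : 0 <= s by rewrite addr_ge0 ?mulr_ge0 ?l1norm_ge0.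
suff Hj k j : l1norm (M ^+ j *m N ^+ k) <= c * q ^+ j * s ^+ k.
  by move=> k; have := Hj k 0; rewrite expr0 mul1mx mulr1.
elim: k j => [|k IH] j; first by rewrite !expr0 mulmx1 mulr1.
have -> : M ^+ j *m N ^+ k.+1 =
    M ^+ j.+1 *m N ^+ k + M ^+ j *m (N - M) *m N ^+ k.
  by rewrite exprS exprSr -mulmxDl -mulmxDr addrC subrK mulmxA.
apply: le_trans (l1normD _ _) _.
apply: le_trans (lerD (IH _) (l1normMM _ _ _)) _.
apply: (@le_trans _ _ (c * q ^+ j.+1 * s ^+ k +
   c * q ^+ j * l1norm (N - M) * (c * s ^+ k))).
  rewrite lerD2l ler_pM ?mulr_ge0 ?l1norm_ge0 //.
    by rewrite ler_wpM2r ?l1norm_ge0.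
  by have := IH 0; rewrite expr0 mul1mx mulr1.
by rewrite /s !exprS le_eqVlt; apply/orP; left; apply/eqP; ring.
Qed.

Lemma stein_iter p (a : K) (M X Y : 'M[K]_p) k :
  X = a *: (M^T *m X *m M) + Y ->
  X = a ^+ k *: ((M ^+ k)^T *m X *m M ^+ k) +
      \sum_(j < k) a ^+ j *: ((M ^+ j)^T *m Y *m M ^+ j).
Proof.
move=> XE; elim: k => [|k IH].
  by rewrite big_ord0 addr0 !expr0 scale1r trmx1 mul1mx mulmx1.
rewrite {1}IH big_ord_recr /= {1}XE mulmxDr mulmxDl scalerDr -addrA.
rewrite [_ + \sum_(_ < _) _]addrC; congr (_ + _).
rewrite -scalemxAr -scalemxAl scalerA -exprSr [M ^+ k.+1]exprS trmx_mul.
by rewrite !mulmxA.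
Qed.

(** Iterate the equation [k] times, with [k] so large that the coefficient of
    [X] on the right is at most 1/2, and absorb that term in the left-hand side.
    The choice of [k], hence the constant, is the same for all the matrices [M]
    that obey the given power bound. *)
Lemma stein_bound p (c q : K) : 0 <= c -> 0 <= q -> q < 1 ->
  exists2 d, 0 <= d & forall (a : K) (M X Y : 'M[K]_p), 0 <= a -> a <= 1 ->
    (forall k, l1norm (M ^+ k) <= c * q ^+ k) ->
    X = a *: (M^T *m X *m M) + Y -> l1norm X <= d * l1norm Y.
Proof.
move=> c0 q0 q1.
have [k ck] : exists k, c ^+ 2 * q ^+ k <= 1 / 2.
  have : (fun k => c ^+ 2 * q ^+ k) @ \oo --> (c ^+ 2 * 0).
    by apply: cvgMr; apply: cvg_expr; rewrite ger0_norm.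
  rewrite mulr0 => /cvgr_le /(_ (1 / 2)) [|k _ Hk]; first by lra.
  by exists k; apply: Hk => /=.
exists (2 * (k%:R * c ^+ 2)); first by rewrite !mulr_ge0 ?exprn_ge0.
move=> a M X Y a0 a1 H XE.
have l1conj j (Z : 'M[K]_p) : l1norm (a ^+ j *: ((M ^+ j)^T *m Z *m M ^+ j)) <=
    c ^+ 2 * q ^+ j * l1norm Z.
  rewrite l1normZ normrX ger0_norm //.
  have Mj : l1norm ((M ^+ j)^T *m Z *m M ^+ j) <= (c * q ^+ j) ^+ 2 * l1norm Z.
    apply: le_trans (l1normMM _ _ _) _; rewrite l1norm_tr mulrAC -expr2.
    rewrite ler_wpM2r ?l1norm_ge0 //.
    by rewrite lerXn2r ?nnegrE ?l1norm_ge0 ?mulr_ge0 ?exprn_ge0.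
  apply: le_trans (ler_piMl _ _) _; rewrite ?l1norm_ge0 ?exprn_ile1 //.
  apply: le_trans Mj _; rewrite ler_wpM2r ?l1norm_ge0 // exprMn.
  by rewrite ler_wpM2l ?exprn_ge0 // expr2 ler_piMl ?exprn_ge0 ?exprn_ile1 // ltW.
have sumY : l1norm (\sum_(j < k) a ^+ j *: ((M ^+ j)^T *m Y *m M ^+ j)) <=
    k%:R * c ^+ 2 * l1norm Y.
  elim: (k) => [|i IH]; first by rewrite big_ord0 l1norm0 !mul0r.
  rewrite big_ord_recr /=; apply: le_trans (l1normD _ _) _.
  rewrite -natr1 !mulrDl mul1r lerD //; apply: le_trans (l1conj _ _) _.
  rewrite ler_wpM2r ?l1norm_ge0 // ler_piMr ?exprn_ge0 ?exprn_ile1 //.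
  exact: ltW.
have : l1norm X <= 1 / 2 * l1norm X + k%:R * c ^+ 2 * l1norm Y.
  rewrite {1}(stein_iter k XE); apply: le_trans (l1normD _ _) _; rewrite lerD //.
  by apply: le_trans (l1conj _ _) _; rewrite ler_wpM2r ?l1norm_ge0.
by lra.
Qed.

Definition power_stable p (M : 'M[K]_p) :=
  exists c q : K, [/\ 0 <= c, 0 <= q, q < 1 &
    forall k, l1norm (M ^+ k) <= c * q ^+ k].

Lemma trmx_exp p (M : 'M[K]_p) k : (M^T) ^+ k = (M ^+ k)^T.
Proof.
elim: k => [|k IH]; first by rewrite !expr0 trmx1.
by rewrite exprS IH exprSr trmx_mul.
Qed.

Lemma power_stable_tr p (M : 'M[K]_p) : power_stable M -> power_stable M^T.
Proof.
move=> [c [q [c0 q0 q1 H]]]; exists c, q; split => // k.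
by rewrite trmx_exp l1norm_tr.
Qed.

Lemma stein_unique p (a : K) (M X X' Y : 'M[K]_p) :
  0 <= a -> a <= 1 -> power_stable M ->
  X = a *: (M^T *m X *m M) + Y -> X' = a *: (M^T *m X' *m M) + Y -> X = X'.
Proof.
move=> a0 a1 [c [q [c0 q0 q1 H]]] XE XE'.
have [d d0 Hd] := stein_bound p c0 q0 q1.
have DE : X - X' = a *: (M^T *m (X - X') *m M) + 0.
  rewrite {1}XE {1}XE' mulmxBr mulmxBl scalerBr addr0 opprD addrACA subrr.
  by rewrite addr0.
apply/subr0_eq/l1norm_eq0/eqP; rewrite eq_le l1norm_ge0 andbT.
by have := Hd _ _ _ _ a0 a1 H DE; rewrite l1norm0 mulr0.
Qed.

(** The map whose bijectivity is the solvability of the Stein equation; it is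
    named so that it can carry a linear structure. *)
Definition stein_op p (a : K) (M X : 'M[K]_p) := X - a *: (M^T *m X *m M).

Lemma stein_op_linear p a (M : 'M[K]_p) : linear (stein_op a M).
Proof.
move=> b X Y; rewrite /stein_op mulmxDr mulmxDl -scalemxAr -scalemxAl.
by rewrite scalerDr scalerBr opprD addrACA !scalerA [a * b]mulrC.
Qed.

HB.instance Definition _ p a (M : 'M[K]_p) :=
  GRing.isLinear.Build K _ _ _ (stein_op a M) (stein_op_linear a M).

Lemma stein_exists p (a : K) (M Y : 'M[K]_p) :
  0 <= a -> a <= 1 -> power_stable M ->
  exists X, X = a *: (M^T *m X *m M) + Y.
Proof.
move=> a0 a1 Mg.
have inj : lker (linfun (stein_op a M)) == 0%VS.
  apply/lker0P => X X'; rewrite !lfunE /= => e.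
  apply: (stein_unique (Y := stein_op a M X) a0 a1 Mg).
    by rewrite /stein_op addrC subrK.
  by rewrite e /stein_op addrC subrK.
have := lker0_lfunVK inj Y.
set X := (_^-1)%VF _; rewrite lfunE /= => e; exists X.
by rewrite -e /stein_op addrC subrK.
Qed.

Lemma stein_sym p (a : K) (M X Y : 'M[K]_p) :
  0 <= a -> a <= 1 -> power_stable M -> Y^T = Y ->
  X = a *: (M^T *m X *m M) + Y -> X^T = X.
Proof.
move=> a0 a1 Mg YT XE; apply: (stein_unique a0 a1 Mg _ XE).
by rewrite {1}XE linearD linearZ /= !trmx_mul trmxK YT mulmxA.
Qed.
End Stein.

(** * First-order expansion of the trace of a Stein solution *)

Section Expansion.
Context {K : realType}.

Lemma mxtraceB p (X Y : 'M[K]_p) : \tr (X - Y) = \tr X - \tr Y.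
Proof. exact: raddfB. Qed.

(** Substitute [G = S - a M S M^T] in [\tr ((P' - P) G)], and use the cyclicity
    of the trace to turn [M S M^T] next to [P' - P] into [M^T (P' - P) M] next to
    [S]. As [S] belongs to [M] alone, [N] enters the right-hand side only through
    the congruence [N^T P' N]. *)
Lemma stein_trace_sub p (a : K) (M N P P' S W G : 'M[K]_p) :
  P = a *: (M^T *m P *m M) + W -> P' = a *: (N^T *m P' *m N) + W ->
  S = a *: (M *m S *m M^T) + G ->
  \tr (P' *m G) - \tr (P *m G) =
  a * \tr ((N^T *m P' *m N - M^T *m P' *m M) *m S).
Proof.
move=> PE PE' SE.
have GE : G = S - a *: (M *m S *m M^T) by rewrite {1}SE addrC addKr.
have DE : P' - P = a *: (N^T *m P' *m N - M^T *m P *m M).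
  by rewrite {1}PE {1}PE' opprD addrACA subrr addr0 -scalerBr.
rewrite -mxtraceB -mulmxBl GE mulmxBr mxtraceB -scalemxAr mxtraceZ.
have -> : \tr ((P' - P) *m (M *m S *m M^T)) =
    \tr ((M^T *m P' *m M - M^T *m P *m M) *m S).
  by rewrite mulmxA mxtrace_mulC !mulmxA mulmxBr !mulmxBl.
rewrite DE -scalemxAl mxtraceZ -mulrBr; congr (_ * _).
by rewrite -mxtraceB -mulmxBl opprB addrA subrK.
Qed.

Lemma congruence_sub p (M E P : 'M[K]_p) :
  (M + E)^T *m P *m (M + E) - M^T *m P *m M =
  E^T *m P *m M + M^T *m P *m E + E^T *m P *m E.
Proof.
have -> : (M + E)^T = M^T + E^T by rewrite linearD.
rewrite !mulmxDl !mulmxDr.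
by rewrite addrC !addrA addNr add0r [X in X + _ = _]addrC.
Qed.

Lemma l1norm_congruence_sub p (M E P : 'M[K]_p) :
  l1norm (E^T *m P *m M + M^T *m P *m E + E^T *m P *m E) <=
  l1norm E * (2 * l1norm M + l1norm E) * l1norm P.
Proof.
apply: le_trans (l1normD _ _) _; apply: le_trans (lerD (l1normD _ _) (lexx _)) _.
apply: le_trans (lerD (lerD (l1normMM _ _ _) (l1normMM _ _ _)) (l1normMM _ _ _)) _.
by rewrite !l1norm_tr le_eqVlt; apply/orP; left; apply/eqP; ring.
Qed.

(** The map [M |-> \tr (P G)] is differentiable, with an error quadratic in [E].
    By [stein_trace_sub] the error is [a \tr ((E^T D M + M^T D E + E^T P' E) S)]
    with [D = P' - P]; here [P'] is bounded uniformly in [E], and [D] solves a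
    Stein equation whose right-hand side is of the order of [E]. *)
Lemma stein_trace_expansion p (a : K) (M S W G P : 'M[K]_p) :
  0 <= a -> a <= 1 -> power_stable M ->
  S = a *: (M *m S *m M^T) + G -> P = a *: (M^T *m P *m M) + W ->
  exists d c : K, [/\ 0 < d, 0 <= c & forall E, l1norm E <= d ->
    power_stable (M + E) /\
    forall P', P' = a *: ((M + E)^T *m P' *m (M + E)) + W ->
    `|\tr (P' *m G) - \tr (P *m G) -
      a * \tr ((E^T *m P *m M + M^T *m P *m E) *m S)| <= c * l1norm E ^+ 2].
Proof.
move=> a0 a1 [c [q [c0 q0 q1 H]]] SE PE.
(* The rate s serves M and all its perturbations M + E with l1norm E <= r. *)
pose s : K := (1 + q) / 2.
have [s0 s1 qs] : [/\ 0 <= s, s < 1 & q <= s] by rewrite /s; split; lra.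
have [d d0 Hd] := stein_bound p c0 s0 s1.
have c1 : 0 < 2 * (c + 1) by lra.
pose r : K := (1 - q) / (2 * (c + 1)).
have r0 : 0 < r by rewrite divr_gt0 // subr_gt0.
have cr : c * r <= s - q.
  rewrite /r mulrA ler_pdivrMr // /s; nra.
set m := l1norm M; have m0 : 0 <= m := l1norm_ge0 M.
set w := l1norm W; have w0 : 0 <= w := l1norm_ge0 W.
(* The bound on l1norm P' is d * w, and that on l1norm D is k * l1norm E. *)
pose k := d * (2 * m + r) * (d * w).
have k0 : 0 <= k.
  by apply: mulr_ge0; [apply: mulr_ge0 => //; lra | exact: mulr_ge0].
exists r, ((2 * m * k + d * w) * l1norm S); split => //.
  by apply: mulr_ge0 (l1norm_ge0 _); apply: addr_ge0; apply: mulr_ge0 => //; lra.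
move=> E Er; set e := l1norm E in Er *; have e0 : 0 <= e := l1norm_ge0 E.
have HE j : l1norm ((M + E) ^+ j) <= c * s ^+ j.
  apply: le_trans (pow_bound_perturbed (M + E) c0 q0 H j) _.
  rewrite [M + E]addrC addrK ler_wpM2l // lerXn2r ?nnegrE //.
    by rewrite addr_ge0 ?mulr_ge0.
  by have := ler_wpM2l c0 Er; rewrite -/e; lra.
have HM j : l1norm (M ^+ j) <= c * s ^+ j.
  by apply: le_trans (H j) _; rewrite ler_wpM2l // lerXn2r ?nnegrE.
split=> [|P' PE']; first by exists c, s.
have P'b : l1norm P' <= d * w := Hd _ _ _ _ a0 a1 HE PE'.
pose D := P' - P.
have DE : D = a *: (M^T *m D *m M) +
    a *: (E^T *m P' *m M + M^T *m P' *m E + E^T *m P' *m E).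
  rewrite -congruence_sub -scalerDr [in LHS]/D {1}PE {1}PE'.
  rewrite opprD addrACA subrr addr0 -scalerBr; congr (_ *: _).
  by rewrite /D mulmxBr mulmxBl [RHS]addrC addrA subrK.
have Db : l1norm D <= e * k.
  apply: le_trans (Hd _ _ _ _ a0 a1 HM DE) _; rewrite l1normZ ger0_norm //.
  rewrite /k [e * _]mulrCA -!mulrA ler_wpM2l //.
  apply: le_trans (ler_piMl (l1norm_ge0 _) a1) _.
  apply: le_trans (l1norm_congruence_sub _ _ _) _.
  rewrite -/e -/m -mulrA [X in _ <= X]mulrC -!mulrA ler_wpM2l //.
  rewrite mulrA [leRHS]mulrC ler_pM ?l1norm_ge0 ?lerD2l //.
  by rewrite addr_ge0 // mulr_ge0.
rewrite (stein_trace_sub PE PE' SE) congruence_sub.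
rewrite -mulrBr -mxtraceB -mulmxBl normrM ger0_norm //.
apply: le_trans (ler_piMl (normr_ge0 _) a1) _.
apply: le_trans (l1norm_trace _) _.
apply: le_trans (l1normM _ _) _.
rewrite [X in _ <= X]mulrAC ler_wpM2r ?l1norm_ge0 //.
have -> : E^T *m P' *m M + M^T *m P' *m E + E^T *m P' *m E -
    (E^T *m P *m M + M^T *m P *m E) =
    E^T *m D *m M + M^T *m D *m E + E^T *m P' *m E.
  by rewrite addrAC opprD addrACA /D !mulmxBr !mulmxBl.
apply: le_trans (l1normD _ _) _; apply: le_trans (lerD (l1normD _ _) (lexx _)) _.
apply: le_trans (lerD (lerD (l1normMM _ _ _) (l1normMM _ _ _)) (l1normMM _ _ _)) _.
rewrite !l1norm_tr -/e -/m.
have h1 := ler_wpM2l (mulr_ge0 e0 m0) Db.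
have h2 := ler_wpM2l (mulr_ge0 e0 e0) P'b.
by nra.
Qed.
End Expansion.

(** * Gradients from quadratic error bounds *)

Section Gradient.
Context {K : realType}.

(** The differential in the definition of a gradient, as a map that can carry a
    linear structure. *)
Definition trace_form m n (X H : 'M[K]_(m, n)) : K := \tr (H^T *m X).

Lemma trace_form_linear m n (X : 'M[K]_(m, n)) :
  linear (trace_form X : _ -> K).
Proof.
move=> a H H'.
by rewrite /trace_form linearP /= mulmxDl -scalemxAl mxtraceD mxtraceZ.
Qed.

HB.instance Definition _ m n (X : 'M[K]_(m, n)) :=
  GRing.isLinear.Build K 'M[K]_(m, n) K _ (trace_form X) (trace_form_linear X).

Lemma l1norm_le_norm m n (H : 'M[K]_(m, n)) :
  l1norm H <= (m * n)%:R * `|H|.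
Proof.
apply: (@le_trans _ _ (\sum_(i < m) \sum_(j < n) `|H|)).
  apply: ler_sum => i _; apply: ler_sum => j _.
  rewrite [leRHS]/Num.norm /= mx_normrE.
  by apply: (le_bigmax_cond _ (fun ij => `|H ij.1 ij.2|) (j := (i, j))).
by rewrite !sumr_const !card_ord -mulrnA mulnC mulr_natl.
Qed.

Lemma is_gradient_quadratic m n (f : 'M[K]_(m, n) -> K) (F X : 'M[K]_(m, n))
    (d c : K) : 0 < d -> 0 <= c ->
  (forall H, l1norm H <= d ->
     `|f (F + H) - f F - \tr (H^T *m X)| <= c * l1norm H ^+ 2) ->
  is_gradient f F X.
Proof.
move=> d0 c0 Hf.
have lc : continuous (trace_form X : 'M[K]_(m, n) -> K).
  apply/linear_bounded_continuous/linear_boundedP.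
  exists ((m * n)%:R * l1norm X); split; first exact: num_real.
  move=> r Hr H; apply: le_trans (l1norm_trace _) _.
  apply: le_trans (l1normM _ _) _; rewrite l1norm_tr.
  apply: le_trans (ler_wpM2r (l1norm_ge0 _) (l1norm_le_norm H)) _.
  by rewrite mulrAC ler_wpM2r // ltW.
pose V : normedModType K := 'M[K]_(m, n); pose W : normedModType K := K.
have small (b t : K) : 0 <= b -> 0 < t -> \forall H \near (0 : V), b * `|H| <= t.
  move=> b0 t0; have b1 : 0 < b + 1 by lra.
  near=> H.
  have : `|H| <= t / (b + 1) by near: H; apply: (@nbhs0_le K V); rewrite divr_gt0.
  by rewrite ler_pdivlMr //; have := normr_ge0 H; lra.
have exp : (f : V -> W) \o shift (F : V) =
    cst (f F) + (trace_form X : V -> W) +o_ (0 : V) id.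
  apply/eqaddoP => e e0; near=> H.
  have Hd : l1norm H <= d.
    apply: le_trans (l1norm_le_norm H) _.
    by near: H; exact: small.
  have -> : (f \o shift F - (cst (f F) + trace_form X)) H =
      f (F + H) - f F - \tr (H^T *m X).
    rewrite -[LHS]/(f (H + F) - (f F + trace_form X H)).
    by rewrite opprD addrA [H + F]addrC.
  apply: le_trans (Hf H Hd) _.
  apply: (@le_trans _ _ (c * ((m * n)%:R * `|H|) ^+ 2)).
    by rewrite ler_wpM2l // lerXn2r ?nnegrE ?l1norm_ge0 ?mulr_ge0 ?l1norm_le_norm.
  rewrite exprMn expr2 !mulrA ler_wpM2r //.
  by near: H; apply: small; rewrite ?mulr_ge0.
apply: DiffDef.
  apply/diff_locallyP; rewrite (diff_unique lc exp); split; [exact: lc|exact: exp].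
exact: (diff_unique lc exp).
Unshelve. all: by end_near.
Qed.
End Gradient.

(** * The augmented system and its cost *)

Section Feedback.
Context {K : realType} {n m : nat}.
Context (A : 'M[K]_n) (B : 'M[K]_(n, m)).
Implicit Types F H : 'M[K]_(m, n).

Lemma augmentedE F : augmented A B F = col_mx 1%:M F *m row_mx A B.
Proof. by rewrite /augmented mul_col_row !mul1mx. Qed.

Lemma augmentedD F H :
  augmented A B (F + H) = augmented A B F + col_mx 0 1%:M *m H *m row_mx A B.
Proof.
rewrite !augmentedE [col_mx 0 _ *m _]mul_col_mx mul0mx mul1mx.
by rewrite -mulmxDl add_col_mx addr0.
Qed.

Lemma augmented_pow F k : augmented A B F ^+ k.+1 =
  col_mx 1%:M F *m (A + B *m F) ^+ k *m row_mx A B.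
Proof.
elim: k => [|k IH]; first by rewrite expr1 expr0 mulmx1 augmentedE.
have -> : (A + B *m F) ^+ k.+1 =
    (A + B *m F) ^+ k *m (row_mx A B *m col_mx 1%:M F).
  by rewrite mul_row_col mulmx1 exprSr.
by rewrite exprSr IH augmentedE -[LHS]/(_ *m _) !mulmxA.
Qed.

(** The spectral hypothesis concerns [A + B F]; powers of the augmented matrix
    are powers of [A + B F] between two fixed factors. *)
Lemma augmented_power_stable F :
  stabilizing A B F -> power_stable (augmented A B F).
Proof.
move=> /spectral_pow_bound [c [q [c0 q0 q1 H]]].
set l := l1norm (col_mx 1%:M F); set r := l1norm (row_mx A B).
have lr0 : 0 <= l * c * r / q by rewrite divr_ge0 ?mulr_ge0 ?l1norm_ge0 // ltW.
exists (l1norm (1%:M : 'M[K]_(n + m)) + l * c * r / q), q.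
split; rewrite ?addr_ge0 ?l1norm_ge0 ?(ltW q0) // => -[|k].
  by rewrite !expr0 mulr1 lerDl.
rewrite augmented_pow; apply: le_trans (l1normMM _ _ _) _.
apply: (@le_trans _ _ (l * (c * q ^+ k) * r)).
  by rewrite ler_wpM2r ?l1norm_ge0 // ler_wpM2l ?l1norm_ge0.
rewrite mulrDl ler_wpDl ?mulr_ge0 ?l1norm_ge0 ?exprn_ge0 ?(ltW q0) //.
rewrite exprS le_eqVlt; apply/orP; left; apply/eqP; field.
by rewrite gt_eqF.
Qed.

Lemma trajectoryE F v k : trajectory A B F v k = augmented A B F ^+ k *m v.
Proof.
elim: k => [|k IH]; first by rewrite expr0 mul1mx.
by rewrite /trajectory iterS -/(trajectory A B F v k) IH exprS mulmxA.
Qed.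

Lemma qform_traceE p (P : 'M[K]_p) (x : 'cV[K]_p) :
  qform P x = \tr (P *m (x *m x^T)).
Proof. by rewrite /qform -trace_mx11 -mulmxA mxtrace_mulC mulmxA. Qed.

Lemma abs_qform p (P : 'M[K]_p) (x : 'cV[K]_p) :
  `|qform P x| <= l1norm P * l1norm x ^+ 2.
Proof.
apply: le_trans (entry_le_l1norm _ _ _) _; apply: le_trans (l1normMM _ _ _) _.
by rewrite l1norm_tr mulrAC mulrC expr2.
Qed.

(** By the Stein equation, [alpha ^ k v_k^T W v_k] is the decrease of
    [alpha ^ k v_k^T P v_k] between the times [k] and [k + 1], so the series
    telescopes; the boundary term vanishes in the limit because [v_k] decays. *)
Lemma cost_stein Q R alpha r (v : 'I_r -> 'cV[K]_(n + m)) F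
    (P : 'M[K]_(n + m)) : 0 <= alpha -> alpha <= 1 ->
  power_stable (augmented A B F) ->
  P = alpha *: ((augmented A B F)^T *m P *m augmented A B F) + weight Q R ->
  cost A B Q R alpha v F = \tr (P *m gram v).
Proof.
move=> a0 a1 [c [q [c0 q0 q1 H]]] PE; set M := augmented A B F in H PE.
rewrite /cost /gram mulmx_sumr raddf_sum /=; apply: eq_bigr => i _.
rewrite -qform_traceE; set x := v i.
pose y k := M ^+ k *m x.
have yS k : y k.+1 = M *m y k by rewrite /y exprS mulmxA.
have entryB (X Y : 'M[K]_1) : (X - alpha *: Y) 0 0 = X 0 0 - alpha * Y 0 0.
  by rewrite !mxE.
have -> : series (fun k =>
      alpha ^+ k * qform (weight Q R) (trajectory A B F x k))
    = (fun k => qform P x - alpha ^+ k * qform P (y k)).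
  apply/funext => k; rewrite /series /=; elim: k => [|k IH].
    by rewrite big_nil expr0 mul1r /y expr0 mul1mx subrr.
  rewrite big_nat_recr //= IH trajectoryE -/(y k) -addrA; congr (_ + _).
  have -> : weight Q R = P - alpha *: (M^T *m P *m M) by rewrite {1}PE addrC addKr.
  rewrite /qform yS trmx_mul mulmxBr mulmxBl -scalemxAr -scalemxAl !mulmxA.
  rewrite entryB.
  by rewrite mulrBr mulrA -exprSr addKr !trmx_mul !mulmxA.
apply: cvg_lim => //; rewrite -[X in _ --> X]subr0.
apply: cvgB; first exact: cvg_cst.
apply/norm_cvg0P.
have qb k : `|alpha ^+ k * qform P (y k)| <= (l1norm P * (c * l1norm x) ^+ 2) * q ^+ k.
  rewrite normrM ger0_norm ?exprn_ge0 //.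
  apply: le_trans (ler_piMl _ _) _; rewrite ?exprn_ile1 //.
  apply: le_trans (abs_qform _ _) _; rewrite -mulrA ler_wpM2l ?l1norm_ge0 //.
  apply: (@le_trans _ _ ((c * l1norm x * q ^+ k) ^+ 2)).
    rewrite lerXn2r ?nnegrE ?l1norm_ge0 ?mulr_ge0 ?l1norm_ge0 ?exprn_ge0 //.
    apply: le_trans (l1normM _ _) _.
    by rewrite mulrAC ler_wpM2r ?l1norm_ge0.
  rewrite exprMn ler_wpM2l ?exprn_ge0 ?mulr_ge0 ?l1norm_ge0 //.
  by rewrite expr2 ler_piMl ?exprn_ge0 ?exprn_ile1 // ltW.
apply: (@squeeze_cvgr _ _ _ _ (cst 0)
  (fun k => (l1norm P * (c * l1norm x) ^+ 2) * q ^+ k)).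
- by near=> k; rewrite normr_ge0 qb.
- exact: cvg_cst.
- rewrite -(mulr0 (l1norm P * (c * l1norm x) ^+ 2)).
  by apply: cvgMr; apply: cvg_expr; rewrite ger0_norm.
Unshelve. all: by end_near.
Qed.

Lemma symmetricmxE p (M : 'M[K]_p) : (M \is symmetricmx) = (M^T == M).
Proof. by rewrite qualifE /= expr0 scale1r map_mx_id // eq_sym. Qed.

(** The two terms of the differential are transposes of each other under the
    trace, whence the factor 2. Then [E] and [M] both end with the factor
    [(A B)], and cycling it around produces [(A B) S (A B)^T], the upper left
    block of [M S M^T]. *)
Lemma feedback_differential (alpha : K) F H (P S Gam : 'M[K]_(n + m)) :
  P^T = P -> S^T = S ->
  S = alpha *: (augmented A B F *m S *m (augmented A B F)^T) + Gam ->
  let M := augmented A B F in let E := col_mx 0 1%:M *m H *m row_mx A B in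
  alpha * \tr ((E^T *m P *m M + M^T *m P *m E) *m S) =
  \tr (H^T *m (2 *: ((ursubmx P)^T *m (ulsubmx S - ulsubmx Gam))
           + 2 *: (drsubmx P *m F *m (ulsubmx S - ulsubmx Gam)))).
Proof.
move=> PT ST SE M E.
have -> : ulsubmx S - ulsubmx Gam = alpha *: (row_mx A B *m S *m (row_mx A B)^T).
  have -> : ulsubmx S - ulsubmx Gam = ulsubmx (S - Gam).
    by apply/matrixP => i j; rewrite !mxE.
  have -> : S - Gam = alpha *: (M *m S *m M^T) by rewrite {1}SE addrK.
  have -> : ulsubmx (alpha *: (M *m S *m M^T)) = alpha *: ulsubmx (M *m S *m M^T).
    by apply/matrixP => i j; rewrite !mxE.
  rewrite /M augmentedE mul_col_mx mul1mx.
  by rewrite !tr_col_mx mul_col_mx mul_col_row block_mxKul.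
rewrite mulmxDl mxtraceD.
have -> : \tr (M^T *m P *m E *m S) = \tr (E^T *m P *m M *m S).
  by rewrite -mxtrace_tr !trmx_mul trmxK PT ST mxtrace_mulC !mulmxA.
have -> : E^T *m P *m M *m S =
  (row_mx A B)^T *m (H^T *m ((ursubmx P)^T + drsubmx P *m F) *m row_mx A B *m S).
  have JPF : (col_mx 0 1%:M)^T *m P *m col_mx 1%:M F =
      (ursubmx P)^T + drsubmx P *m F.
    rewrite trmx_ursub PT -{1}[P]submxK tr_col_mx trmx0 trmx1 mul_row_block.
    by rewrite !mul0mx !mul1mx !add0r mul_row_col mulmx1.
  by rewrite -JPF /E /M augmentedE !trmx_mul !mulmxA.
rewrite mxtrace_mulC -scalerDr -mulmxDl -!scalemxAr !mxtraceZ !mulmxA.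
by ring.
Qed.
End Feedback.

(** * The gradient of the cost *)

Theorem proposition2 (K : realType) (n m r : nat)
    (A : 'M[K]_n) (B : 'M[K]_(n, m)) (Q : 'M[K]_n) (R : 'M[K]_m) (alpha : K)
    (v : 'I_r -> 'cV[K]_(n + m)) (Gam : 'M[K]_(n + m)) (F : 'M[K]_(m, n)) :
  psdmx Q -> pdmx R -> 0 < alpha -> alpha <= 1 ->
  Gam = gram v -> pdmx Gam ->
  stabilizing A B F ->
  exists S P : 'M[K]_(n + m),
    [/\ unique (is_lyapunov_S A B alpha F Gam) S,
        unique (is_lyapunov_P A B Q R alpha F) P &
        is_gradient (cost A B Q R alpha v) F
          (2 *: ((ursubmx P)^T *m (ulsubmx S - ulsubmx Gam))
           + 2 *: (drsubmx P *m F *m (ulsubmx S - ulsubmx Gam)))].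
Proof.
move=> [QT _] [RT _] /ltW a0 a1 GamE [GamT _] Fst.
rewrite !symmetricmxE in QT RT GamT.
set M := augmented A B F.
have Mg : power_stable M := augmented_power_stable Fst.
have MTg := power_stable_tr Mg.
have WT : (weight Q R)^T = weight Q R.
  by rewrite /weight tr_block_mx !trmx0 (eqP QT) (eqP RT).
have [S SE] := stein_exists Gam a0 a1 MTg.
have [P PE] := stein_exists (weight Q R) a0 a1 Mg.
have PT := stein_sym a0 a1 Mg WT PE.
have ST := stein_sym a0 a1 MTg (eqP GamT) SE.
exists S, P; split.
- split; first by split; [rewrite symmetricmxE ST | rewrite trmxK in SE].
  move=> S' [_ SE']; apply: (stein_unique a0 a1 MTg SE).
  by rewrite trmxK.
- have PQ (X : 'M[K]_(n + m)) : alpha *: (M^T *m X *m M) - X + weight Q R = 0 <->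
      X = alpha *: (M^T *m X *m M) + weight Q R.
    rewrite addrAC; split=> [/subr0_eq -> //|<-].
    by rewrite subrr.
  split; first by split; [rewrite symmetricmxE PT | apply/PQ].
  by move=> P' [_ /PQ PE']; exact: (stein_unique a0 a1 Mg PE PE').
rewrite trmxK in SE.
(* A change H of the gain perturbs M by a matrix of norm at most e * l1norm H. *)
have [d [c [d0 c0 Hexp]]] := stein_trace_expansion a0 a1 Mg SE PE.
pose e := l1norm (col_mx 0 1%:M : 'M[K]_(n + m, m)) * l1norm (row_mx A B).
have e0 : 0 <= e by rewrite mulr_ge0 ?l1norm_ge0.
apply: (@is_gradient_quadratic _ _ _ _ _ _ (d / (e + 1)) (c * e ^+ 2)).
- by rewrite divr_gt0 //; lra.
- by rewrite mulr_ge0 ?exprn_ge0.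
move=> H Hd; pose E := (col_mx 0 1%:M : 'M[K]_(n + m, m)) *m H *m row_mx A B.
have Eb : l1norm E <= e * l1norm H.
  by apply: le_trans (l1normMM _ _ _) _; rewrite mulrAC.
have [|ME Hexp'] := Hexp E.
  apply: le_trans Eb _; move: Hd; rewrite ler_pdivlMr; last by apply: ltr_wpDl.
  by have := l1norm_ge0 H; lra.
have [P' PE'] := stein_exists (weight Q R) a0 a1 ME.
rewrite (cost_stein v a0 a1 Mg PE) -(feedback_differential H PT ST SE) -/M -/E.
rewrite (@cost_stein _ _ _ _ _ _ _ _ _ _ _ P') ?augmentedD //.
rewrite -GamE; apply: le_trans (Hexp' _ PE') _.
by rewrite -mulrA ler_wpM2l // -exprMn lerXn2r ?nnegrE ?mulr_ge0 ?l1norm_ge0.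
Qed.
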